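(* Let $L,H>0$, $\Omega=(0,L)\times(0,H)$, and let $c=c(x_2)$ satisfy one of the following: (i) there are an integer $N\ge1$, numbers $0=h_{-1}<h_0<h_1<\dots<h_{N-1}<h_N=H$ and $0<c_0<c_1<\dots<c_N$ such that $c=c_i$ for $h_{i-1}<x_2<h_i$, $i=0,\dots,N$; or (ii) $c\in C^1([0,H])$ is strictly increasing and positive on $[0,H]$. Let $A$ be either $-c\Delta$ or $-\nabla\cdot(c\nabla)$ with Dirichlet boundary conditions on $\Omega$, with eigenvalues $\lambda_{k,\ell}$ and eigenfunctions $v_{k,\ell}$ ($k,\ell\ge1$). Put $c_H:=\sup_{0<x_2<H}c(x_2)$. Fix $\varepsilon>0$ and an open set $\omega=\omega_1\times(a,b)\subset\Omega$ with $\omega_1\subset(0,L)$ nonempty open and $0\le a<b\le H$. Then there is a constant $C_\omega>0$ such that for every eigenfunction $v_{k,\ell}$ associated with the eigenvalue $\lambda_{k,\ell}$, $$\lambda_{k,\ell}>(c_H+\varepsilon)\frac{k^2\pi^2}{L^2}\ \Longrightarrow\ 0<C_\omega\le\frac{\|v_{k,\ell}\|_{L^2(\omega)}}{\|v_{k,\ell}\|_{L^2(\Omega)}}\le1 .$$ Moreover the constant $C_\omega$ is invariant under translations of $\omega$ (the same constant serves for every translate of $\omega$ contained in $\Omega$).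
   Context: The operator $-c\Delta$ acts in $L^2(\Omega,c^{-1}dx)$ with domain $H^1_0(\Omega)\cap H^2(\Omega)$; the operator $-\nabla\cdot(c\nabla)$ acts in $L^2(\Omega,dx)$ with domain $\{u\in H^1_0(\Omega):\nabla\cdot(c\nabla u)\in L^2(\Omega)\}$. For each integer $k\ge1$, $\lambda_{k,1}<\lambda_{k,2}<\cdots$ are the real numbers $\lambda$ for which there is a nonzero solution $u=u_{k,\ell}$, with $u(0)=u(H)=0$, of $u''+(\frac{\lambda}{c}-\frac{k^2\pi^2}{L^2})u=0$ (when $A=-c\Delta$; $u,u'$ continuous), respectively $(cu')'+(\lambda-c\frac{k^2\pi^2}{L^2})u=0$ (when $A=-\nabla\cdot(c\nabla)$; $u,cu'$ continuous). The eigenfunctions are $v_{k,\ell}(x)=a_{k,\ell}\sin(\frac{k\pi}{L}x_1)u_{k,\ell}(x_2)$ with normalizing constants $a_{k,\ell}\ne0$; they form an orthonormal basis. *)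

(* Defs.v *)
From HB Require Import structures.
From mathcomp Require Import all_boot all_order all_algebra.
From mathcomp Require Import all_classical all_reals all_analysis.

Set Implicit Arguments.
Unset Strict Implicit.
Unset Printing Implicit Defensive.
Import Order.TTheory GRing.Theory Num.Theory.
Import numFieldNormedType.Exports.
Local Open Scope classical_set_scope.
Local Open Scope ring_scope.

(* Piecewise constant c on (0, H) with N + 1 layers. The indices of the
   interfaces are shifted by one: [h i] stands for h_{i-1}, so h_{-1} = 0 is
   [h 0] and h_N = H is [h N.+1]. The values of c at the interfaces are
   unspecified; D is the set {h_0, ..., h_{N-1}} of these points. *)
Definition layered (R : realType) (H : R) (c : R -> R) (D : set R) : Prop :=
  exists (N : nat) (h : nat -> R) (cl : nat -> R),
    [/\ (1 <= N)%N,
        h 0%N = 0 /\ h N.+1 = H,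
        (forall i, (i <= N)%N -> h i < h i.+1),
        0 < cl 0%N /\ (forall i, (i < N)%N -> cl i < cl i.+1) &
        (forall i x, (i <= N)%N -> h i < x < h i.+1 -> c x = cl i) /\
        D = [set x | exists2 i, (1 <= i <= N)%N & x = h i]].

(* C^1 on the closed interval: the derivative on the open interval extends
   continuously to the closed one. *)
Definition C1_closed (R : realType) (a b : R) (f : R -> R) : Prop :=
  {within `[a, b], continuous f} /\
  exists2 g : R -> R, {within `[a, b], continuous g} &
    forall x, a < x < b -> is_derive x 1 f (g x).

Definition smooth_increasing (R : realType) (H : R) (c : R -> R) (D : set R)
    : Prop :=
  [/\ C1_closed 0 H c,
      {in `[0, H] &, {homo c : x y / x < y}},
      {in `[0, H], forall x, 0 < c x} &
      D = set0].

(* D is the finite set of points of (0, H) at which c is left unspecified. *)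
Definition admissible (R : realType) (H : R) (c : R -> R) (D : set R) : Prop :=
  layered H c D \/ smooth_increasing H c D.

(* sup of c over the points of (0, H) where c is specified. *)
Definition csup (R : realType) (H : R) (c : R -> R) (D : set R) : R :=
  sup (c @` (`]0, H[ `\` D)).

Inductive operator :=
| NonDivergence (* - c Delta, in L^2(Omega, dx / c) *)
| Divergence.   (* - div (c grad), in L^2(Omega, dx) *)

(* The function w is u' (resp. c u'), extended to a continuous function on
   [0, H]: c need not be specified on D, and the equation is required off D
   only, the transmission conditions there being the continuity of u and w. *)
Definition separated_solution (R : realType) (A : operator) (L H : R)
    (c : R -> R) (D : set R) (k : nat) (lambda : R) (u : R -> R) : Prop :=
  [/\ {within `[0, H], continuous u},
      u 0 = 0, u H = 0 &
      exists2 w : R -> R, {within `[0, H], continuous w} &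
        forall x, 0 < x < H -> ~ D x ->
          [/\ derivable u x 1, derivable w x 1 &
              match A with
              | NonDivergence =>
                  w x = (u^`())%classic x /\
                  (w^`())%classic x
                    + (lambda / c x - k%:R ^+ 2 * pi ^+ 2 / L ^+ 2) * u x = 0
              | Divergence =>
                  w x = c x * (u^`())%classic x /\
                  (w^`())%classic x
                    + (lambda - c x * (k%:R ^+ 2 * pi ^+ 2 / L ^+ 2)) * u x = 0
              end]].

Definition separated_eigenpair (R : realType) (A : operator) (L H : R)
    (c : R -> R) (D : set R) (k : nat) (lambda : R) (u : R -> R) : Prop :=
  separated_solution A L H c D k lambda u /\ exists2 x, 0 <= x <= H & u x != 0.

Definition rectangle (R : realType) (L H : R) : set (R * R) :=
  `]0, L[ `*` `]0, H[.

Definition area (R : realType) :=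
  (@lebesgue_measure R \x @lebesgue_measure R)%E.

Definition eigenfunction (R : realType) (L : R) (a : R) (k : nat) (u : R -> R)
    (x : R * R) : R :=
  a * sin (k%:R * pi / L * x.1) * u x.2.

Definition weight (R : realType) (A : operator) (c : R -> R) (x : R * R) : R :=
  match A with
  | NonDivergence => (c x.2)^-1
  | Divergence => 1
  end.

(* lambda k l, u k l, a k l are only meaningful for k, l >= 1. For each k the
   sequence lambda k 1 < lambda k 2 < ... enumerates all the real numbers
   admitting a nonzero solution, and a k l normalizes the eigenfunction in the
   L^2 space on which A acts. *)
Definition spectral_data (R : realType) (A : operator) (L H : R)
    (c : R -> R) (D : set R) (lambda : nat -> nat -> R)
    (u : nat -> nat -> R -> R) (a : nat -> nat -> R) : Prop :=
  forall k, (1 <= k)%N ->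
    [/\ forall l l', (1 <= l)%N -> (l < l')%N -> lambda k l < lambda k l',
        forall mu, (exists y, separated_eigenpair A L H c D k mu y) <->
                   (exists2 l, (1 <= l)%N & mu = lambda k l),
        forall l, (1 <= l)%N ->
          separated_eigenpair A L H c D k (lambda k l) (u k l) &
        forall l, (1 <= l)%N ->
          a k l != 0 /\
          (\int[@area R]_(x in rectangle L H)
             (weight A c x * eigenfunction L (a k l) k (u k l) x ^+ 2)%:E
           = 1)%E].

Definition L2norm (R : realType) (W : set (R * R)) (f : R * R -> R) : R :=
  fine ('N[@area R]_(2%:E) [EFin \o patch (fun=> 0%R) W f])%E.

Definition translate (R : realType) (t : R * R) (W : set (R * R))
    : set (R * R) :=
  [set x + t | x in W].

(* Main.v *)
Require Import Defs.
From HB Require Import structures.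
From mathcomp Require Import all_boot all_order all_algebra.
From mathcomp Require Import all_classical all_reals all_analysis.
From mathcomp Require Import measurable_realfun ring lra.

Set Implicit Arguments.
Unset Strict Implicit.
Unset Printing Implicit Defensive.
Import Order.TTheory GRing.Theory Num.Theory.
Import numFieldNormedType.Exports.
Local Open Scope classical_set_scope.
Local Open Scope ring_scope.

(** Both operators lead to the same kind of first-order system. With w = u'
    (resp. w = c u') the separated equation reads u' = alpha w, w' = - beta u,
    where alpha = 1, beta = lambda / c - kappa (resp. alpha = 1 / c,
    beta = lambda - kappa c) and kappa = k^2 pi^2 / L^2. Since c increases,
    alpha and beta are nonincreasing. Moreover alpha lies between two positive
    constants and, thanks to lambda > (c_H + eps) kappa, so does beta / lambda,
    uniformly in k and l.

    Two energies carry the proof: E = beta u^2 + alpha w^2 is nonincreasing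
    and F = u^2 / alpha + w^2 / beta = E / (alpha beta) is nondecreasing
    ([weighted_energy_noninc]). This uses the coefficients through their
    monotonicity alone, so layers and smooth profiles are treated at once.
    Hence E >= E(H) = alpha(H) beta(H) F(H), which dominates lambda u(x)^2 up
    to a constant, for every x. Multiplying the system by a bump function phi
    supported in [a, b] and integrating (phi u w)' shows that the integral of
    phi E over [a, b], thus E(H), is at most a multiple of lambda times the
    integral of u^2 over [a, b] ([oscillator_mass]). Dividing by lambda,
    sup u^2 is bounded by a constant times the integral of u^2 over [a, b], a
    constant in which the interval enters through b - a only
    ([oscillator_observable]).

    The horizontal factor sin (k pi x / L) solves the same system with
    alpha = 1 and beta = (k pi / L)^2, so the same bump argument bounds its
    mass below on any segment of given length ([sin_mass]). Fubini's theorem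
    multiplies the two bounds ([eigenfunction_ratio]). *)

(** * Monotonicity from local estimates *)

(** Induction on the number of exceptional points: cut the segment at one of
    them. *)
Lemma le_off_finite (R : realType) (s : seq R) (f : R -> R) (a b : R) :
  a <= b -> {within `[a, b], continuous f} ->
  (forall x, a < x < b -> x \notin s ->
     exists2 df, is_derive x 1 f df & 0 <= df) ->
  f a <= f b.
Proof.
have [n] := ubnP (size s); elim: n s a b => // n IHn s a b sn ab fc fd.
have [/hasP[d ds /andP[ad db]]|/hasPn nods] := boolP (has (fun d => a < d < b) s).
  have szs : (size (rem d s) < n)%N.
    by rewrite size_rem //; case: (s) ds sn.
  have sub p q : a <= p -> q <= b -> {within `[p, q], continuous f}.
    move=> ap qb; apply: continuous_subspaceW fc.
    by apply: subset_itv; rewrite bnd_simp.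
  have rems x : x != d -> x \notin rem d s -> x \notin s.
    move=> xd; apply: contra => xs; move: (perm_mem (perm_to_rem ds) x).
    by rewrite xs inE (negPf xd).
  apply: (@le_trans _ _ (f d)).
    apply: (IHn (rem d s)) => //; [exact: ltW|exact: sub (ltW db)|].
    move=> x /andP[ax xd] xs; apply: fd; first by rewrite ax (lt_trans xd).
    by apply: rems xs; rewrite lt_eqF.
  apply: (IHn (rem d s)) => //; [exact: ltW|exact: sub (ltW ad) _|].
  move=> x /andP[ax xd] xs; apply: fd; first by rewrite xd (lt_trans ad).
  by apply: rems xs; rewrite gt_eqF.
have fd' x : a < x < b -> exists2 df, is_derive x 1 f df & 0 <= df.
  by move=> xab; apply: fd => //; apply: contraL xab; exact: nods.
apply: (@ger0_derive1_le_cc _ f a b) => //; rewrite ?in_itv /= ?lexx ?ab //.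
  by move=> x; rewrite in_itv /= => /fd'[df dfx _]; exact: ex_derive.
by move=> x; rewrite in_itv /= => /fd'[df dfx df0]; rewrite derive1E derive_val.
Qed.

(** The hypothesis is quadratic in y - x up to the increment of S, which is
    additive: halving the segment n times divides the right-hand side by
    2 ^ n. This replaces the Stieltjes integral of u^2 with respect to the
    coefficients in the energy identity. *)
Lemma noninc_bisection (R : realType) (E S : R -> R) (a b : R) :
  (forall x y, a <= x -> x <= y -> y <= b ->
     E y - E x <= (S x - S y) * (y - x)) ->
  forall x y, a <= x -> x <= y -> y <= b -> E y <= E x.
Proof.
move=> ES.
have halves n x y : a <= x -> x <= y -> y <= b ->
    E y - E x <= (S x - S y) * (y - x) / 2 ^+ n.
  elim: n x y => [|n IHn] x y ax xy yb; first by rewrite expr0 divr1 ES.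
  pose m := (x + y) / 2.
  have xm : x <= m by rewrite /m; lra.
  have my : m <= y by rewrite /m; lra.
  have := lerD (IHn x m ax xm (le_trans my yb)) (IHn m y (le_trans ax xm) my yb).
  have -> : m - x = (y - x) / 2 by rewrite /m; field.
  have -> : y - m = (y - x) / 2 by rewrite /m; field.
  rewrite exprS invfM => h.
  apply: le_trans (le_trans _ h) _; first by lra.
  by rewrite le_eqVlt; apply/orP; left; apply/eqP; ring.
move=> x y ax xy yb; rewrite leNgt; apply/negP => Exy.
pose K := (S x - S y) * (y - x).
have e0 : 0 < E y - E x by rewrite subr_gt0.
have := archi_boundP (ltW (divr_gt0 (lt_le_trans e0 (ES x y ax xy yb)) e0)).
set n := Num.bound _ => nE.
have := halves n x y ax xy yb; rewrite leNgt => /negP; apply.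
rewrite ltr_pdivrMr ?exprn_gt0 // [ltRHS]mulrC -ltr_pdivrMr //.
by apply: lt_trans nE _; rewrite -natrX ltr_nat; exact: ltn_expl.
Qed.

(** * First-order systems with monotone coefficients *)

(** The system u' = alpha w, w' = - beta u, required off a finite set of points
    where alpha and beta may jump while u and w remain continuous. *)
Definition oscillator (R : realType) (a b : R) (s : seq R)
    (alpha beta u w : R -> R) : Prop :=
  [/\ {within `[a, b], continuous u}, {within `[a, b], continuous w} &
      forall x, a < x < b -> x \notin s ->
        is_derive x 1 u (alpha x * w x) /\
        is_derive x 1 w (- (beta x * u x))].

Lemma oscillator_sub (R : realType) (a b a' b' : R) s (alpha beta u w : R -> R) :
  a <= a' -> b' <= b -> oscillator a b s alpha beta u w ->
  oscillator a' b' s alpha beta u w.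
Proof.
move=> aa bb [uc wc d].
have sub : `[a', b'] `<=` `[a, b] by apply: subset_itv; rewrite bnd_simp.
split; [exact: continuous_subspaceW uc|exact: continuous_subspaceW wc|].
move=> x /andP[ax xb]; apply: d; rewrite (le_lt_trans aa ax) /=.
exact: lt_le_trans xb bb.
Qed.

Lemma within_bounded (R : realType) (a b : R) (f : R -> R) :
  {within `[a, b], continuous f} ->
  exists2 M, 0 <= M & forall x, a <= x <= b -> `|f x| <= M.
Proof.
move=> fc; have [ba|ab] := ltP b a.
  exists 0 => // x /andP[ax xb]; have := le_lt_trans (le_trans ax xb) ba.
  by rewrite ltxx.
have [p _ fp] := EVT_max ab fc; have [q _ fq] := EVT_min ab fc.
exists (`|f p| + `|f q|); first by rewrite addr_ge0.
move=> x xab; rewrite ler_norml; apply/andP; split.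
  rewrite lerNl; apply: le_trans (_ : - f q <= _).
    by rewrite lerN2 fq // in_itv.
  by rewrite (le_trans (ler_norm _)) // normrN lerDr.
by rewrite (le_trans (fp x _)) ?in_itv // (le_trans (ler_norm _)) // lerDl.
Qed.

Lemma within_continuousM (R : realType) (A : set R) (f g : R -> R) :
  {within A, continuous f} -> {within A, continuous g} ->
  {within A, continuous (fun x => f x * g x)}.
Proof. by move=> fc gc x; apply: cvgM; [exact: fc|exact: gc]. Qed.

Lemma within_continuousD (R : realType) (A : set R) (f g : R -> R) :
  {within A, continuous f} -> {within A, continuous g} ->
  {within A, continuous (fun x => f x + g x)}.
Proof. by move=> fc gc x; apply: cvgD; [exact: fc|exact: gc]. Qed.

Lemma is_derive1D (R : realType) (f g : R -> R) (x df dg : R) :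
  is_derive x 1 f df -> is_derive x 1 g dg ->
  is_derive x 1 (fun t => f t + g t) (df + dg).
Proof. by move=> hf hg; exact: is_deriveD. Qed.

Lemma is_derive1M (R : realType) (f g : R -> R) (x df dg : R) :
  is_derive x 1 f df -> is_derive x 1 g dg ->
  is_derive x 1 (fun t => f t * g t) (df * g x + f x * dg).
Proof.
move=> hf hg; apply: (@is_derive_eq _ _ _ _ _ _ _ _ (is_deriveM hf hg)).
by rewrite addrC mulrC; congr (_ + _); exact: mulrC.
Qed.

Lemma is_derive1Z (R : realType) (k : R) (f : R -> R) (x df : R) :
  is_derive x 1 f df -> is_derive x 1 (fun t => k * f t) (k * df).
Proof. by move=> hf; exact: is_deriveZ. Qed.

(** Formally d(P u^2 + Q w^2) = u^2 dP + w^2 dQ <= 0, because the terms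
    2 P alpha u w and - 2 Q beta u w cancel. On a short segment [x, y] the
    weights are frozen at their values in y: the derivative of
    P(y) u^2 + Q(y) w^2 is at most a constant times the variation of P + Q, and
    [noninc_bisection] removes this error. *)
Lemma weighted_energy_noninc (R : realType) (a b : R) s
    (alpha beta u w P Q : R -> R) (M : R) :
  oscillator a b s alpha beta u w ->
  (forall x, 0 < alpha x <= M) -> (forall x, 0 < beta x <= M) ->
  {homo P : x y /~ x <= y} -> {homo Q : x y /~ x <= y} ->
  (forall x, P x * alpha x = Q x * beta x) ->
  forall x y, a <= x -> x <= y -> y <= b ->
    P y * u y ^+ 2 + Q y * w y ^+ 2 <= P x * u x ^+ 2 + Q x * w x ^+ 2.
Proof.
move=> osc aM bM Pd Qd PQ.
have [uc wc _] := osc.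
have [N N0 uwN] := within_bounded (within_continuousM uc wc).
(* K bounds both |(u^2)'| and |(w^2)'|. *)
pose K := 2 * M * N.
have M0 : 0 <= M by have /andP[/ltW h1 h2] := aM 0; exact: le_trans h1 h2.
apply: (@noninc_bisection _ _ (fun x => K * (P x + Q x))) => x y ax xy yb.
have {osc} [uc' wc' d] := oscillator_sub ax yb osc.
have PP : P y <= P x by exact: Pd.
have QQ : Q y <= Q x by exact: Qd.
pose G t := K * (P x + Q x - (P y + Q y)) * t
            + (- P y * (u t * u t) + - Q y * (w t * w t)).
have cc k : {within `[x, y], continuous (fun _ : R => k : R)}.
  by move=> ?; exact: cvg_cst.
have idc : {within `[x, y], continuous (fun t : R => t)}.
  by apply: continuous_subspaceT => ?; exact: cvg_id.
have Gxy : G x <= G y.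
  apply: (@le_off_finite _ s _ _ _ xy).
    apply: within_continuousD; first exact: within_continuousM.
    by apply: within_continuousD; apply: within_continuousM => //;
       exact: within_continuousM.
  move=> t txy ts; have [du dw] := d t txy ts; have /andP[xt ty] := txy.
  have sq k f df (dfx : is_derive t 1 f df) :=
    is_derive1Z k (is_derive1M dfx dfx).
  have lin k := is_derive1Z k (is_derive_id t 1).
  eexists.
    exact: is_derive1D (lin _) (is_derive1D (sq _ _ _ du) (sq _ _ _ dw)).
  have Pxt : P t <= P x by rewrite Pd // ltW.
  have Pty : P y <= P t by rewrite Pd // ltW.
  have Qxt : Q t <= Q x by rewrite Qd // ltW.
  have Qty : Q y <= Q t by rewrite Qd // ltW.
  have t_ab : a <= t <= b.
    by rewrite (le_trans ax (ltW xt)) (le_trans (ltW ty) yb).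
  have bound k (k0 : 0 < k <= M) r : `|r| <= N -> `|2 * (k * r)| <= K.
    move=> rN; have /andP[/ltW k1 k2] := k0.
    rewrite /K -mulrA !normrM ger0_norm // (ger0_norm k1) ler_pM2l //.
    exact: ler_pM.
  have /ler_normlP[X1 _] := bound _ (aM t) _ (uwN t t_ab).
  have /ler_normlP[_ Y2] := bound _ (bM t) _ (uwN t t_ab).
  have K0 : 0 <= K by rewrite !mulr_ge0.
  have p1 : 0 <= (P t - P y) * (K + 2 * (alpha t * (u t * w t))).
    by apply: mulr_ge0; lra.
  have p2 : 0 <= (Q t - Q y) * (K - 2 * (beta t * (u t * w t))).
    by rewrite mulr_ge0 ?subr_ge0.
  have p3 : 0 <= K * (P x - P t) by rewrite mulr_ge0 ?subr_ge0.
  have p4 : 0 <= K * (Q x - Q t) by rewrite mulr_ge0 ?subr_ge0.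
  have p5 : P t * alpha t * (u t * w t) = Q t * beta t * (u t * w t).
    by rewrite PQ.
  lra.
have r1 : 0 <= (P x - P y) * u x ^+ 2 by rewrite mulr_ge0 ?subr_ge0 ?sqr_ge0.
have r2 : 0 <= (Q x - Q y) * w x ^+ 2 by rewrite mulr_ge0 ?subr_ge0 ?sqr_ge0.
have := Gxy; rewrite /G.
lra.
Qed.

(** Let e be a lower bound of the energy beta u^2 + alpha w^2 on ]a, b[. With
    phi = ((x - a) (b - x))^2,
      (phi u w)' = phi' u w + phi (alpha w^2 + beta u^2) - 2 phi beta u^2,
    and the square structure of phi lets half of phi alpha w^2 absorb phi' u w,
    at the price of a multiple of u^2. Integration kills the boundary terms and
    phi has integral (b - a)^5 / 30. *)
Lemma oscillator_mass (R : realType) (a b : R) s (alpha beta u w : R -> R)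
    (a0 b1 e : R) :
  a < b -> oscillator a b s alpha beta u w -> 0 < a0 -> 0 <= b1 ->
  (forall x, a0 <= alpha x) -> (forall x, beta x <= b1) ->
  (forall x, a < x < b -> e <= beta x * u x ^+ 2 + alpha x * w x ^+ 2) ->
  e * (b - a) ^+ 5 / 60 <=
  (2 * (b - a) ^+ 4 * b1 + 2 * (b - a) ^+ 2 / a0) *
    \int[@lebesgue_measure R]_(x in `[a, b]) (u x ^+ 2).
Proof.
move=> ab [uc wc d] a0_gt0 b1_ge0 al bl el.
set B := 2 * _ * _ + _.
have u2c : {within `[a, b], continuous (fun x => u x ^+ 2)}.
  exact: within_continuousM.
have u2i : (@lebesgue_measure R).-integrable `[a, b]
             (EFin \o (fun x => u x ^+ 2)).
  by apply: continuous_compact_integrable => //; exact: segment_compact.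
pose U x := \int[@lebesgue_measure R]_(y in `[a, x]) (u y ^+ 2).
have Uc : {within `[a, b], continuous U}.
  exact: (parameterized_integral_continuous (ltW ab) u2i).
have dU x : a < x < b -> is_derive x 1 U (u x ^+ 2).
  move=> /andP[ax xb].
  have u2x : {for x, continuous (fun x => u x ^+ 2)}.
    move/continuous_within_itvP : u2c => /(_ ab)[+ _ _]; apply.
    by rewrite in_itv /= ax.
  have [dU U'] := continuous_FTC1_closed xb u2i ax u2x.
  by rewrite -U' derive1E; exact: DeriveDef.
pose d1 := b - a.
(* the bump function and its primitive *)
pose phi (x : R) : R := ((x - a) * (b - x)) ^+ 2.
pose Phi (x : R) : R := d1 ^+ 2 * (x - a) ^+ 3 / 3 - d1 * (x - a) ^+ 4 / 2
              + (x - a) ^+ 5 / 5.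
have dphi (x : R) : is_derive x 1 phi (2 * ((x - a) * (b - x)) * (a + b - 2 * x)).
  by apply: is_derive_eq; rewrite /GRing.scale /=; ring.
have dPhi (x : R) : is_derive x 1 Phi (phi x).
  by apply: is_derive_eq; rewrite /GRing.scale /= /phi /d1; field.
have Phic : continuous Phi.
  by move=> x; apply/differentiable_continuous/derivable1_diffP/ex_derive.
have phic : continuous phi.
  by move=> x; apply/differentiable_continuous/derivable1_diffP/ex_derive.
pose G x := phi x * (u x * w x) + (B * U x + (- (e / 2)) * Phi x).
(* G' >= 0 is the differential form of the integrated inequality. *)
have : G a <= G b.
  apply: (@le_off_finite _ s) (ltW ab) _ _.
    have cc k : {within `[a, b], continuous (fun _ : R => k : R)}.
      by move=> ?; exact: cvg_cst.
    apply: within_continuousD; first apply: within_continuousM.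
    - exact: continuous_subspaceT.
    - exact: within_continuousM.
    - by apply: within_continuousD; apply: within_continuousM => //;
       exact: continuous_subspaceT.
  move=> x xab xs; have [du dw] := d x xab xs.
  eexists.
    exact: is_derive1D (is_derive1M (dphi x) (is_derive1M du dw))
      (is_derive1D (is_derive1Z B (dU x xab)) (is_derive1Z (- (e / 2)) (dPhi x))).
  have /andP[ax xb] := xab.
  have := el x xab; have := al x; have := bl x.
  set p := alpha x; set q := beta x; set y := u x; set z := w x => qb ap epq.
  rewrite /phi; set h := (x - a) * (b - x); set k := a + b - 2 * x.
  have h0 : 0 <= h by apply: mulr_ge0; lra.
  have hd : h <= d1 ^+ 2 by rewrite /h /d1 expr2; apply: ler_pM; lra.
  have kd : k ^+ 2 <= d1 ^+ 2.
    by rewrite -ler_sqrt ?sqr_ge0 // !sqrtr_sqr (@gtr0_norm _ d1) ?subr_gt0 //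
               ler_norml /k /d1; lra.
  have p_gt0 : 0 < p by apply: lt_le_trans ap.
  have y0 := sqr_ge0 y.
  have i1 : 0 <= h ^+ 2 * (q * y ^+ 2 + p * z ^+ 2 - e).
    by rewrite mulr_ge0 ?sqr_ge0 ?subr_ge0.
  (* Completing the square of phi alpha w^2 / 2 + phi' u w. *)
  have i2 : 0 <= p / 2 * (h * z + 2 * k * y / p) ^+ 2.
    by rewrite mulr_ge0 ?sqr_ge0 // divr_ge0 // ltW.
  have i2E : p / 2 * (h * z + 2 * k * y / p) ^+ 2 =
      p * h ^+ 2 * z ^+ 2 / 2 + 2 * h * k * y * z + 2 * (k ^+ 2 / p * y ^+ 2).
    by field; rewrite gt_eqF.
  have i3 : k ^+ 2 / p * y ^+ 2 <= d1 ^+ 2 / a0 * y ^+ 2.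
    apply: ler_wpM2r => //; apply: ler_pM; rewrite ?sqr_ge0 //.
      by rewrite invr_ge0 ltW.
    by rewrite lef_pV2.
  have i4 : h ^+ 2 * y ^+ 2 * q <= h ^+ 2 * y ^+ 2 * b1.
    by apply: ler_wpM2l => //; rewrite mulr_ge0 ?sqr_ge0.
  have i5 : h ^+ 2 * (y ^+ 2 * b1) <= d1 ^+ 4 * (y ^+ 2 * b1).
    apply: ler_wpM2r; first by rewrite mulr_ge0.
    by rewrite (exprM d1 2 2) lerXn2r // nnegrE ?sqr_ge0.
  have i6 : 0 <= h ^+ 2 * (y ^+ 2 * b1).
    by apply: mulr_ge0 (sqr_ge0 _) (mulr_ge0 _ _).
  rewrite /B -/d1; move: i2 i3; rewrite i2E.
  set A0 := d1 ^+ 2 / a0; set A1 := k ^+ 2 / p.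
  have -> : 2 * d1 ^+ 2 / a0 = 2 * A0 by rewrite /A0 mulrA.
  lra.
rewrite /G.
have -> : U a = 0 by rewrite /U set_itv1 Rintegral_set1.
have -> : phi a = 0 by rewrite /phi subrr mul0r expr0n.
have -> : phi b = 0 by rewrite /phi subrr mulr0 expr0n.
have -> : Phi a = 0 by rewrite /Phi subrr !expr0n /=; ring.
have -> : Phi b = d1 ^+ 5 / 30 by rewrite /Phi /d1; field.
rewrite -/(U b) /d1; lra.
Qed.

(** Since F is nondecreasing, u(x)^2 / a1 <= F(H), and since E is nonincreasing,
    E >= alpha(H) beta(H) F(H) >= a0 b0 lam u(x)^2 / a1 on all of [0, H]: this is
    the energy bound fed to [oscillator_mass]. The parameter lam then cancels,
    lam0 <= lam being used for the term of [oscillator_mass] that does not grow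
    with beta. *)
Lemma oscillator_observable (R : realType) (H a b : R) s
    (alpha beta u w : R -> R) (a0 a1 b0 b1 lam0 lam : R) :
  0 <= a -> a < b -> b <= H -> oscillator 0 H s alpha beta u w ->
  0 < a0 -> 0 < b0 -> 0 < lam0 -> lam0 <= lam ->
  {homo alpha : x y /~ x <= y} -> {homo beta : x y /~ x <= y} ->
  (forall x, a0 <= alpha x <= a1) ->
  (forall x, b0 * lam <= beta x <= b1 * lam) ->
  forall x, 0 <= x <= H ->
  a0 * b0 / a1 * (b - a) ^+ 5 / 60 * u x ^+ 2 <=
  (2 * (b - a) ^+ 4 * b1 + 2 * (b - a) ^+ 2 / (a0 * lam0)) *
    \int[@lebesgue_measure R]_(y in `[a, b]) (u y ^+ 2).
Proof.
move=> age0 ab bH osc a0_gt0 b0_gt0 lam0_gt0 lamge an bn aP bP x /andP[x0 xH].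
have lam_gt0 : 0 < lam by exact: lt_le_trans lamge.
have a1_gt0 : 0 < a1.
  by have /andP[h1 h2] := aP 0; exact: lt_le_trans (le_trans h1 h2).
have b0l : 0 < b0 * lam by exact: mulr_gt0.
have b1l : 0 < b1 * lam.
  by have /andP[h1 h2] := bP 0; exact: lt_le_trans (le_trans h1 h2).
have al_gt0 z : 0 < alpha z.
  by have /andP[h1 _] := aP z; exact: lt_le_trans h1.
have be_gt0 z : 0 < beta z.
  by have /andP[h1 _] := bP z; exact: lt_le_trans h1.
pose M := a1 + b1 * lam.
have alM z : 0 < alpha z <= M.
  rewrite al_gt0 /=; have /andP[_ h] := aP z.
  by rewrite (le_trans h) // lerDl ltW.
have beM z : 0 < beta z <= M.
  rewrite be_gt0 /=; have /andP[_ h] := bP z.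
  by rewrite (le_trans h) // lerDr ltW.
pose F z := u z ^+ 2 / alpha z + w z ^+ 2 / beta z.
have FxH : F x <= F H.
  have invn (f : R -> R) : (forall z, 0 < f z) -> {homo f : x y /~ x <= y} ->
      {homo (fun z => - (f z)^-1) : x y /~ x <= y}.
    by move=> f0 fn y z yz; rewrite lerN2 lef_pV2 ?posrE // fn.
  have PQ z : - (alpha z)^-1 * alpha z = - (beta z)^-1 * beta z.
    by rewrite !mulNr !mulVf // gt_eqF.
  have := weighted_energy_noninc osc alM beM (invn _ al_gt0 an)
            (invn _ be_gt0 bn) PQ x0 xH (lexx H).
  rewrite /F !mulNr -!opprD lerN2 => h.
  by rewrite ![_ ^+ 2 / _]mulrC.
have Fx : u x ^+ 2 / a1 <= F x.
  rewrite /F -[leLHS]addr0; apply: lerD.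
    apply: ler_wpM2l; first exact: sqr_ge0.
    rewrite lef_pV2 ?posrE //.
    by have /andP[] := aP x.
  by rewrite divr_ge0 ?sqr_ge0 // ltW.
(* The lower bound of the energy E. *)
pose e := a0 * (b0 * lam) / a1 * u x ^+ 2.
have eE y : a < y < b -> e <= beta y * u y ^+ 2 + alpha y * w y ^+ 2.
  move=> /andP[ay yb].
  have PQ z : beta z * alpha z = alpha z * beta z by rewrite mulrC.
  have := weighted_energy_noninc osc alM beM bn an PQ
            (le_trans age0 (ltW ay)) (le_trans (ltW yb) bH) (lexx H).
  apply: le_trans.
  have -> : beta H * u H ^+ 2 + alpha H * w H ^+ 2 = alpha H * beta H * F H.
    by rewrite /F; field; rewrite !gt_eqF.
  have -> : e = a0 * (b0 * lam) * (u x ^+ 2 / a1).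
    by rewrite /e; ring.
  have /andP[h1 _] := aP H; have /andP[h2 _] := bP H.
  apply: ler_pM; rewrite ?(le_trans Fx) //.
  - by rewrite mulr_ge0 // ltW.
  - by rewrite divr_ge0 ?sqr_ge0 // ltW.
  - by apply: ler_pM => //; exact: ltW.
have a0P z : a0 <= alpha z by have /andP[] := aP z.
have b1P z : beta z <= b1 * lam by have /andP[] := bP z.
have := oscillator_mass ab (oscillator_sub age0 bH osc) a0_gt0 (ltW b1l) a0P b1P eE.
have : 0 <= \int[@lebesgue_measure R]_(y in `[a, b]) (u y ^+ 2).
  by apply: Rintegral_ge0 => y _; exact: sqr_ge0.
set I := \int[_]_(_ in _) _ => I0 mass.
rewrite -(ler_pM2r lam_gt0).
set q := (b - a) ^+ 5 in mass *.
have -> : a0 * b0 / a1 * q / 60 * u x ^+ 2 * lam = e * q / 60 by rewrite /e; ring.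
apply: le_trans mass _; rewrite [leRHS]mulrAC; apply: ler_wpM2r => //.
rewrite [leRHS]mulrDl lerD //; first by rewrite !mulrA.
rewrite -[leRHS]mulrA; apply: ler_wpM2l; first by rewrite mulr_ge0 ?sqr_ge0.
rewrite invfM -mulrA ler_peMr //; first by rewrite invr_ge0 ltW.
by rewrite mulrC ler_pdivlMr // mul1r.
Qed.

(** The pair (sin (m x), m cos (m x)) solves the system with alpha = 1 and
    beta = m^2, and its energy is the constant m^2. The resulting bound depends
    on the segment through its length only and is uniform in m >= m0. *)
Lemma sin_mass (R : realType) (m0 m p q : R) :
  0 < m0 -> m0 <= m -> p < q ->
  (q - p) ^+ 5 / 60 <= (2 * (q - p) ^+ 4 + 2 * (q - p) ^+ 2 / m0 ^+ 2) *
    \int[@lebesgue_measure R]_(x in `[p, q]) (sin (m * x) ^+ 2).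
Proof.
move=> m0_gt0 m0m pq.
have m_gt0 : 0 < m by exact: lt_le_trans m0m.
have osc : oscillator p q [::] (fun=> 1) (fun=> m ^+ 2)
             (fun x => sin (m * x)) (fun x => m * cos (m * x)).
  have ds (x : R) : is_derive x 1 (fun x => sin (m * x)) (1 * (m * cos (m * x))).
    by apply: is_derive_eq; rewrite /GRing.scale /=; ring.
  have dc (x : R) : is_derive x 1 (fun x => m * cos (m * x))
                      (- (m ^+ 2 * sin (m * x))).
    by apply: is_derive_eq; rewrite /GRing.scale /=; ring.
  split=> //; apply: continuous_subspaceT => x;
    by apply/differentiable_continuous/derivable1_diffP/ex_derive.
have el (x : R) : p < x < q -> m ^+ 2 <=
    m ^+ 2 * sin (m * x) ^+ 2 + 1 * (m * cos (m * x)) ^+ 2.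
  by move=> _; rewrite mul1r exprMn -mulrDr addrC cos2Dsin2 mulr1.
have := oscillator_mass pq osc ltr01 (sqr_ge0 m) (fun=> lexx _) (fun=> lexx _) el.
have : 0 <= \int[@lebesgue_measure R]_(x in `[p, q]) (sin (m * x) ^+ 2).
  by apply: Rintegral_ge0 => y _; exact: sqr_ge0.
set I := \int[_]_(_ in _) _ => I0 mass.
have m2_gt0 : 0 < m ^+ 2 by exact: exprn_gt0.
rewrite -(ler_pM2l m2_gt0) mulrA; apply: le_trans mass _.
rewrite [leRHS]mulrA; apply: ler_wpM2r => //.
rewrite [leRHS]mulrDr lerD //; first by rewrite mulrC.
rewrite divr1 [leRHS]mulrCA ler_peMr //; first by rewrite mulr_ge0 ?sqr_ge0.
rewrite ler_pdivlMr ?exprn_gt0 // mul1r lerXn2r // nnegrE; exact: ltW.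
Qed.

(** * Monotone extension of the speed profile *)

(** The extension takes at x the supremum of the values of c on S to the left
    of x, the value m being added for the points that have no point of S on
    their left. *)
Lemma monotone_extension (R : realType) (S : set R) (c : R -> R) (m M : R) :
  S !=set0 -> (forall x, S x -> m <= c x <= M) ->
  (forall x y, S x -> S y -> x <= y -> c x <= c y) ->
  exists ct : R -> R,
    [/\ {homo ct : x y / x <= y}, forall x, m <= ct x <= sup (c @` S) &
        forall x, S x -> ct x = c x].
Proof.
move=> [z Sz] cb cm.
pose T x := [set m] `|` c @` (S `&` [set y | y <= x]).
have bS : has_ubound (c @` S).
  by exists M => _ [y Sy <-]; have /andP[] := cb y Sy.
have msup : m <= sup (c @` S).
  have /andP[mz _] := cb z Sz; apply: le_trans mz _.
  by apply: ub_le_sup => //; exists z.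
have T0 x : T x !=set0 by exists m; left.
have Tb x : ubound (T x) (sup (c @` S)).
  by move=> _ [->//|[y [Sy _] <-]]; apply: ub_le_sup => //; exists y.
have Tsup x : has_sup (T x) by split; [exact: T0|exists (sup (c @` S)); exact: Tb].
exists (fun x => sup (T x)); split.
- move=> x y xy; apply: ge_sup => // r Tr.
  apply: ub_le_sup; first by case: (Tsup y).
  case: Tr => [->|[t [St tx] <-]]; first by left.
  by right; exists t => //; split=> //; exact: le_trans xy.
- move=> x; apply/andP; split; last exact: ge_sup.
  by apply: ub_le_sup; [case: (Tsup x)|left].
- move=> x Sx; apply/eqP; rewrite eq_le; apply/andP; split.
    apply: ge_sup => // _ [->|[t [St tx] <-]]; first by have /andP[] := cb x Sx.
    exact: cm.
  apply: ub_le_sup; first by case: (Tsup x).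
  by right; exists x => //; split=> //=.
Qed.

Lemma layered_interval (R : realType) (N : nat) (h : nat -> R) (x : R) :
  h 0%N < x -> x < h N.+1 -> (forall i, (1 <= i <= N)%N -> x != h i) ->
  exists2 i, (i <= N)%N & h i < x < h i.+1.
Proof.
move=> x0; elim: N => [|N IHN] xN xh; first by exists 0%N => //; rewrite x0.
have [xlt|xgt|xeq] := ltgtP x (h N.+1).
- have [|i iN hi] := IHN xlt; last by exists i => //; exact: leqW.
  by move=> i /andP[i1 iN]; rewrite xh // i1 leqW.
- by exists N.+1 => //; rewrite xgt.
- by have := xh N.+1; rewrite ltnSn /= xeq eqxx => /(_ isT).
Qed.

(** Layered and smooth profiles meet here: all that is kept of c is a monotone
    positive function on the whole line, bounded by the supremum of c, which
    agrees with c off a finite set. *)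
Lemma admissible_extension (R : realType) (H : R) (c : R -> R) (D : set R) :
  0 < H -> admissible H c D ->
  exists (s : seq R) (ct : R -> R) (m : R),
    [/\ 0 < m, {homo ct : x y / x <= y},
        forall x, m <= ct x <= csup H c D,
        forall x, 0 < x < H -> ~ D x -> ct x = c x &
        forall x, D x -> x \in s].
Proof.
move=> H0 hc.
suff [s [m [M [Sne [m0 cb cm Ds]]]]] : exists (s : seq R) (m M : R),
    (`]0, H[ `\` D) !=set0 /\
    [/\ 0 < m, forall x, (`]0, H[ `\` D) x -> m <= c x <= M,
        forall x y, (`]0, H[ `\` D) x -> (`]0, H[ `\` D) y -> x <= y ->
          c x <= c y &
        forall x, D x -> x \in s].
  have [ct [ctm ctb ctE]] := monotone_extension Sne cb cm.
  exists s, ct, m; split=> // x xH nDx; apply: ctE; split=> //.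
case: hc => [[N [h [cl [N1 [h0 hN] hi [cl0 clS] [cE DE]]]]]|[_ cinc cpos DE]].
- have hmono i j : (i <= j)%N -> (j <= N.+1)%N -> h i <= h j.
    move=> ij; elim: j ij => [|j IHj]; first by rewrite leqn0 => /eqP ->.
    rewrite leq_eqVlt => /predU1P[->//|]; rewrite ltnS => ij jN.
    by rewrite (le_trans (IHj ij (ltnW jN))) // ltW // hi.
  have clmono i j : (i <= j)%N -> (j <= N)%N -> cl i <= cl j.
    move=> ij; elim: j ij => [|j IHj]; first by rewrite leqn0 => /eqP ->.
    rewrite leq_eqVlt => /predU1P[->//|]; rewrite ltnS => ij jN.
    by rewrite (le_trans (IHj ij (ltnW jN))) // ltW // clS.
  have layer x : (`]0, H[ `\` D) x -> exists2 i, (i <= N)%N & h i < x < h i.+1.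
    rewrite /= in_itv /= => -[/andP[x0 xH] nD].
    apply: layered_interval; rewrite ?h0 ?hN // => i iN.
    by apply/eqP => xi; apply: nD; rewrite DE; exists i.
  exists [seq h i | i <- iota 0 N.+1], (cl 0%N), (cl N); split; [|split=> //].
  + pose z := h 1%N / 2.
    have h1 : 0 < h 1%N by rewrite -h0 hi.
    have h1H : h 1%N <= H by rewrite -hN hmono.
    exists z; split; first by rewrite /= in_itv /= /z; lra.
    rewrite DE => -[i /andP[i1 iN] zi].
    by have := hmono _ _ i1 (leqW iN); rewrite -zi /z; lra.
  + move=> x /layer[i iN xi]; rewrite (cE i x iN xi).
    by rewrite !clmono.
  + move=> x y /layer[i iN xi] /layer[j jN yj] xy.
    rewrite (cE i x iN xi) (cE j y jN yj); apply: clmono => //.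
    rewrite leqNgt; apply/negP => ji.
    have := hmono _ _ ji (leqW iN).
    move: xi yj => /andP[? _] /andP[_ ?]; lra.
  + move=> x; rewrite DE => -[i /andP[_ iN] ->].
    by apply/mapP; exists i => //; rewrite mem_iota.
- have mono x y : 0 <= x -> x <= y -> y <= H -> c x <= c y.
    move=> x0; rewrite le_eqVlt => /predU1P[->//|xy yH].
    apply: ltW; apply: cinc => //; rewrite in_itv /= ?x0 ?yH ?andbT /=.
      exact: ltW (lt_le_trans xy yH).
    exact: ltW (le_lt_trans x0 xy).
  have mem x : (`]0, H[ `\` D) x -> 0 <= x <= H.
    by rewrite /= in_itv /= => -[/andP[/ltW -> /ltW ->]].
  exists [::], (c 0), (c H); split; [|split].
  + by exists (H / 2); split; [rewrite /= in_itv /=; lra|rewrite DE].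
  + by apply: cpos; rewrite in_itv /= lexx ltW.
  + by move=> x /mem /andP[x0 xH]; rewrite !mono.
  + by move=> x y /mem /andP[x0 xH] /mem /andP[y0 yH] xy; exact: mono.
  + by move=> x; rewrite DE.
Qed.

(** * The separated equation as a first-order system *)

Definition first_coefficient (R : realType) (A : operator) (ct : R -> R)
    (x : R) : R :=
  match A with NonDivergence => 1 | Divergence => (ct x)^-1 end.

Definition second_coefficient (R : realType) (A : operator) (ct : R -> R)
    (kappa lam x : R) : R :=
  match A with
  | NonDivergence => lam / ct x - kappa
  | Divergence => lam - ct x * kappa
  end.

Lemma separated_oscillator (R : realType) (A : operator) (L H : R)
    (c ct : R -> R) (D : set R) s (k : nat) (lam : R) (u : R -> R) :
  (forall x, 0 < ct x) ->
  (forall x, 0 < x < H -> ~ D x -> ct x = c x) ->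
  (forall x, D x -> x \in s) ->
  separated_solution A L H c D k lam u ->
  exists w, oscillator 0 H s (first_coefficient A ct)
    (second_coefficient A ct (k%:R ^+ 2 * pi ^+ 2 / L ^+ 2) lam) u w.
Proof.
move=> ct0 ctc Ds [uc _ _ [w wc uw]]; exists w; split=> // x xH xs.
have nD : ~ D x by move=> /Ds; apply/negP.
have [du dw ode] := uw x xH nD.
suff [<- <-] : u^`()%classic x = first_coefficient A ct x * w x /\
    w^`()%classic x =
      - (second_coefficient A ct (k%:R ^+ 2 * pi ^+ 2 / L ^+ 2) lam x * u x).
  by rewrite !derive1E; split; exact: DeriveDef.
case: A ode {uw}; rewrite -(ctc x xH nD) /= => -[-> /eqP weq].
  by rewrite mul1r; split=> //; apply/eqP; rewrite -addr_eq0.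
rewrite mulKf ?gt_eqF //; split=> //.
by apply/eqP; rewrite -addr_eq0.
Qed.

(** The constants are independent of kappa and lam. From
    kappa < lam / (M + eps) one gets lam / c - kappa >=
    (1 / M - 1 / (M + eps)) lam in the nondivergence case and
    lam - c kappa >= (1 - M / (M + eps)) lam in the divergence case. *)
Lemma coefficient_bounds (R : realType) (A : operator) (ct : R -> R)
    (m M eps : R) :
  0 < m -> 0 < eps -> {homo ct : x y / x <= y} ->
  (forall x, m <= ct x <= M) ->
  exists a0 a1 b0 b1 : R,
    [/\ 0 < a0, 0 < a1, 0 < b0, 0 < b1 &
    forall kappa lam, 0 <= kappa -> (M + eps) * kappa < lam ->
      [/\ {homo first_coefficient A ct : x y /~ x <= y},
          {homo second_coefficient A ct kappa lam : x y /~ x <= y},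
          forall x, a0 <= first_coefficient A ct x <= a1 &
          forall x, b0 * lam <= second_coefficient A ct kappa lam x
                    <= b1 * lam]].
Proof.
move=> m0 eps0 ctm ctb.
have ct0 x : 0 < ct x by have /andP[h _] := ctb x; exact: lt_le_trans h.
have M0 : 0 < M by have /andP[_ h] := ctb 0; exact: lt_le_trans (ct0 0) h.
have Me0 : 0 < M + eps by exact: addr_gt0.
have inv x : M^-1 <= (ct x)^-1 <= m^-1.
  by have /andP[h1 h2] := ctb x; rewrite !lef_pV2 ?posrE // h1 h2.
have invn : {homo (fun x => (ct x)^-1) : x y /~ x <= y}.
  by move=> x y xy; rewrite lef_pV2 ?posrE // ctm.
have lam0 kappa lam : 0 <= kappa -> (M + eps) * kappa < lam -> 0 < lam.
  by move=> k0; apply: le_lt_trans; rewrite mulr_ge0 // ltW.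
have kl kappa lam : (M + eps) * kappa < lam -> kappa <= lam / (M + eps).
  by move=> /ltW h; rewrite ler_pdivlMr // mulrC.
case: A.
- exists 1, 1, (M^-1 - (M + eps)^-1), m^-1; split=> //.
  + by rewrite subr_gt0 ltf_pV2 ?posrE // ltrDl.
  + by rewrite invr_gt0.
  move=> kappa lam k0 klam; have l0 := lam0 _ _ k0 klam.
  split=> /=.
  + by [].
  + by move=> x y xy; rewrite lerD2r; apply: ler_wpM2l (invn _ _ xy); exact: ltW.
  + by move=> x; rewrite lexx.
  + move=> x; have /andP[i1 i2] := inv x; apply/andP; split.
      rewrite mulrBl lerB // mulrC; last exact: kl.
      by apply: ler_wpM2l => //; exact: ltW.
    rewrite lerBlDr; apply: le_trans (_ : lam * m^-1 <= _).
      by apply: ler_wpM2l => //; exact: ltW.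
    by rewrite mulrC lerDl.
- exists M^-1, m^-1, (1 - M / (M + eps)), 1; split; rewrite ?invr_gt0 //.
  + by rewrite subr_gt0 ltr_pdivrMr // mul1r ltrDl.
  move=> kappa lam k0 klam; have l0 := lam0 _ _ k0 klam.
  split=> //=.
  + by move=> x y xy; rewrite lerD2l lerN2 ler_wpM2r // ctm.
  + move=> x; have /andP[i1 i2] := ctb x; apply/andP; split.
      rewrite mulrBl mul1r lerD2l lerN2 -mulrA [_^-1 * _]mulrC.
      apply: ler_pM => //; [exact: ltW|exact: kl].
    by rewrite mul1r gerBl mulr_ge0 // ltW.
Qed.

(** * Norms over product sets and translates *)

(** When the integral is infinite, both sides are 0: [fine] sends +oo to 0. *)
Lemma L2normE (R : realType) (W : set (R * R)) (f : R * R -> R) :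
  L2norm W f = Num.sqrt (fine (\int[@area R]_(x in W) (f x ^+ 2)%:E)%E).
Proof.
rewrite /L2norm unlock /=.
have -> : (\int[@area R]_x `|(patch (fun=> 0) W f x)%:E| `^ 2)%E =
          (\int[@area R]_(x in W) (f x ^+ 2)%:E)%E.
  rewrite [RHS]integral_mkcond; apply: eq_integral => x _.
  rewrite /= /patch powR_mulrn ?normr_ge0 // real_normK ?num_real //.
  by case: ifP => // _; rewrite expr0n.
have : (0 <= \int[@area R]_(x in W) (f x ^+ 2)%:E)%E.
  by apply: integral_ge0 => x _; rewrite lee_fin sqr_ge0.
case: (\int[_]_(_ in _) _)%E => [r| |] //=.
- by move=> r0; rewrite powR12_sqrt.
- by move=> _; rewrite sqrtr0 invr_eq0 pnatr_eq0.
Qed.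

Lemma L2norm_ratio (R : realType) (W Om : set (R * R)) (f : R * R -> R) (k : R) :
  measurable W -> measurable Om -> W `<=` Om -> measurable_fun Om f ->
  let I V := (\int[@area R]_(x in V) (f x ^+ 2)%:E)%E in
  (0 < I W)%E -> (k%:E * I Om <= I W)%E -> (I Om < +oo)%E ->
  Num.sqrt k <= L2norm W f / L2norm Om f <= 1.
Proof.
move=> mW mOm WOm mf I IW0 kI Ioo.
have IWOm : (I W <= I Om)%E.
  apply: ge0_subset_integral => //.
    by apply/measurable_EFinP; exact: measurable_funX.
  by move=> x _; rewrite lee_fin sqr_ge0.
rewrite !L2normE -/(I W) -/(I Om).
have := lt_le_trans IW0 IWOm; move: kI Ioo IW0 IWOm.
case: (I Om) => [y| |] //; case: (I W) => [x| |] //=.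
rewrite -EFinM !lee_fin !lte_fin => kyx _ x0 xy y0.
rewrite ler_pdivlMr ?sqrtr_gt0 // ler_pdivrMr ?sqrtr_gt0 // mul1r.
rewrite (ler_wsqrtr xy) andbT.
have [k0|k0] := leP 0 k; first by rewrite -sqrtrM // ler_wsqrtr.
by rewrite ltr0_sqrtr // mul0r sqrtr_ge0.
Qed.

Lemma measurable_fun_separated (R : realType) (I J : set R) (g h : R -> R) :
  measurable I -> measurable J -> measurable_fun I g -> measurable_fun J h ->
  measurable_fun (I `*` J) (fun x => g x.1 * h x.2).
Proof.
move=> mI mJ mg mh; apply: measurable_funM.
  apply: (measurable_comp mI _ mg) => [x [y [] ? ? <-] //|].
  exact: measurable_funS measurable_fst.
apply: (measurable_comp mJ _ mh) => [x [y [] ? ? <-] //|].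
exact: measurable_funS measurable_snd.
Qed.

Lemma integral_separated (R : realType) (I J : set R) (g h : R -> R) :
  measurable I -> measurable J -> measurable_fun I g -> measurable_fun J h ->
  (\int[@area R]_(x in I `*` J) ((g x.1 * h x.2) ^+ 2)%:E =
   (\int[@lebesgue_measure R]_(x in I) (g x ^+ 2)%:E) *
   (\int[@lebesgue_measure R]_(y in J) (h y ^+ 2)%:E))%E.
Proof.
move=> mI mJ mg mh.
have mIJ : measurable (I `*` J) by exact: measurableX.
have m2 : measurable_fun (I `*` J) (fun x => ((g x.1 * h x.2) ^+ 2)%:E).
  apply/measurable_EFinP/measurable_funX; exact: measurable_fun_separated.
rewrite integral_mkcond fubini_tonelli1; last 2 first.
- exact/(measurable_restrictT _ _).1.
- by move=> x; apply: erestrict_ge0 => y _; rewrite lee_fin sqr_ge0.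
have h0 : (0 <= \int[@lebesgue_measure R]_(y in J) (h y ^+ 2)%:E)%E.
  by apply: integral_ge0 => y _; rewrite lee_fin sqr_ge0.
rewrite -ge0_integralZr //; last 2 first.
- by apply/measurable_EFinP/measurable_funX.
- by move=> x _; rewrite lee_fin sqr_ge0.
rewrite [RHS]integral_mkcond; apply: eq_integral => x _.
rewrite /fubini_F /patch /=; case: ifPn => [xI|xI]; last first.
  rewrite integral0_eq // => y _; case: ifPn => //.
  by rewrite !inE /= => -[xI' _]; move: xI; rewrite notin_setE.
rewrite -ge0_integralZl //; last 3 first.
- by apply/measurable_EFinP/measurable_funX.
- by move=> y _; rewrite lee_fin sqr_ge0.
- by rewrite lee_fin sqr_ge0.
rewrite [RHS]integral_mkcond; apply: eq_integral => y _; rewrite /patch /=.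
have -> : ((x, y) \in I `*` J) = (y \in J).
  apply/idP/idP; rewrite !inE /=; first by case.
  by move=> yJ; split=> //; rewrite inE in xI.
by case: ifP => // _; rewrite exprMn EFinM.
Qed.

Lemma integral_continuousE (R : realType) (a b : R) (f : R -> R) :
  {within `[a, b], continuous f} ->
  (\int[@lebesgue_measure R]_(x in `[a, b]) (f x)%:E)%E =
  (\int[@lebesgue_measure R]_(x in `[a, b]) f x)%:E.
Proof.
move=> fc; rewrite /Rintegral fineK //; apply: integrable_fin_num => //.
by apply: continuous_compact_integrable => //; exact: segment_compact.
Qed.

Lemma area_rectangle (R : realType) (L H : R) : 0 < L -> 0 < H ->
  @area R (rectangle L H) = (L * H)%:E.
Proof.
move=> L0 H0; rewrite /area /rectangle product_measure1E //=.
by rewrite !lebesgue_measure_itv /= !lte_fin L0 H0 -!EFinB !subr0 -EFinM.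
Qed.

Lemma open_segment (R : realType) (O : set R) : open O -> O !=set0 ->
  exists p q : R, p < q /\ `[p, q] `<=` O.
Proof.
move=> Oo [x Ox]; have /nbhs_ballP[e /= e0 xe] := open_nbhs_nbhs (conj Oo Ox).
exists (x - e / 2), (x + e / 2); split; first lra.
move=> y /=; rewrite in_itv /= => /andP[xy yx]; apply: xe.
by rewrite /ball /= ltr_norml; apply/andP; split; lra.
Qed.

Lemma translate_strip (R : realType) (O : set R) (a b : R) (t : R * R) :
  translate t (O `*` `]a, b[) =
  [set x | O (x - t.1)] `*` `]a + t.2, b + t.2[.
Proof.
case: t => t1 t2; apply/seteqP; split=> [_ [[x y] [/= Ox yab]] <-|[x y] [/= Ox]].
  move: yab; rewrite /= !in_itv /= => /andP[ay yb].
  by split; [rewrite addrK|rewrite !ltrD2r ay yb].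
rewrite in_itv /= => /andP[ay yb]; exists (x - t1, y - t2).
  by split=> //=; rewrite in_itv /= ltrBrDr ltrBlDr ay.
by congr pair; rewrite subrK.
Qed.

Lemma sub_itvoo_le (R : realType) (a b c d : R) :
  a < b -> (forall x, a < x < b -> c < x < d) -> c <= a /\ b <= d.
Proof.
move=> ab sub; split; rewrite leNgt; apply/negP => lt.
  have /sub/andP[] : a < (a + Num.min b c) / 2 < b.
    by case: (leP b c) => ?; lra.
  by case: (leP b c) => ?; lra.
have /sub/andP[] : a < (b + Num.max a d) / 2 < b.
  by case: (leP a d) => ?; lra.
by case: (leP a d) => ?; lra.
Qed.

(** * Observation of the eigenfunctions *)

(** sg and kp are the observability constants of the two factors. On the
    rectangle v^2 <= amp^2 J / kp pointwise, J being the integral of u^2 over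
    [a, b], so v^2 has integral at most amp^2 (J / kp) L H there. On
    [p, q] x ]a, b[, which lies in W, its integral is at least amp^2 sg J. *)
Lemma eigenfunction_ratio (R : realType) (L H : R) (hL : 0 < L) (hH : 0 < H)
    (W : set (R * R)) (p q a b : R) (k : nat) (u : R -> R) (amp sg kp : R) :
  measurable W -> W `<=` rectangle L H ->
  `[p, q] `*` `]a, b[ `<=` W ->
  p < q -> a < b -> 0 <= a -> b <= H ->
  {within `[0, H], continuous u} ->
  (exists2 x, 0 <= x <= H & u x != 0) -> amp != 0 ->
  0 < sg -> 0 < kp ->
  sg <= \int[@lebesgue_measure R]_(x in `[p, q]) (sin (k%:R * pi / L * x) ^+ 2) ->
  (forall x, 0 <= x <= H ->
    kp * u x ^+ 2 <= \int[@lebesgue_measure R]_(x in `[a, b]) (u x ^+ 2)) ->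
  let v := eigenfunction L amp k u in
  Num.sqrt (sg * kp / (L * H)) <=
    L2norm W v / L2norm (rectangle L H) v <= 1.
Proof.
move=> mW WO pqW pq ab a0 bH uc [x0 x0H ux0] amp0 sg0 kp0.
set S := \int[_]_(_ in _) _; set J := \int[_]_(_ in _) _ => Sge Jge /=.
set v := eigenfunction L amp k u.
have L0 : 0 < L * H by exact: mulr_gt0.
have J0 : 0 < J.
  by apply: lt_le_trans (Jge _ x0H); rewrite mulr_gt0 // exprn_even_gt0.
have amp2 : 0 < amp ^+ 2 by rewrite exprn_even_gt0.
pose g x : R := sin (k%:R * pi / L * x).
have gc : continuous g.
  by move=> x; apply/differentiable_continuous/derivable1_diffP/ex_derive.
have vE : v = (fun x => (amp * g x.1) * u x.2) by [].
have agc : continuous (fun x => amp * g x).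
  by move=> x; apply: cvgM; [exact: cvg_cst|exact: gc].
have mg I : measurable I -> measurable_fun I (fun x => amp * g x).
  by move=> mI; apply: measurable_funTS; exact: continuous_measurable_fun.
have mu_ I : measurable I -> I `<=` `[0, H] -> measurable_fun I u.
  move=> mI IH; apply: (measurable_funS _ IH) => //.
  exact: subspace_continuous_measurable_fun.
have mrect : measurable (rectangle L H) by exact: measurableX.
have mv : measurable_fun (rectangle L H) v.
  rewrite vE; apply: (@measurable_fun_separated _ _ _ (fun x => amp * g x) u) => //.
    exact: mg.
  by apply: mu_ => //; apply: subset_itv; rewrite bnd_simp.
have abH : `[a, b] `<=` `[0, H] by apply: subset_itv; rewrite bnd_simp.
have abH' : `]a, b[ `<=` `[0, H] by apply: subset_itv; rewrite bnd_simp.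
have core : (\int[@area R]_(x in `[p, q] `*` `]a, b[) (v x ^+ 2)%:E =
             (amp ^+ 2 * S * J)%:E)%E.
  rewrite vE (@integral_separated _ _ _ (fun x => amp * g x) u) //; last 2 first.
  - exact: mg.
  - exact: mu_.
  rewrite EFinM; congr (_ * _)%E.
    under eq_integral do rewrite exprMn.
    have sc : {within `[p, q], continuous (fun x => g x ^+ 2)}.
      by apply: continuous_subspaceT => x; apply: cvgM; exact: gc.
    rewrite integral_continuousE; last first.
      by apply: within_continuousM => // x; exact: cvg_cst.
    rewrite RintegralZl //.
    by apply: continuous_compact_integrable => //; exact: segment_compact.
  rewrite -(@integral_itv_bndoo _ a b _ true false); last first.
    by apply/measurable_EFinP/measurable_funX; exact: mu_.
  rewrite integral_continuousE //; apply: within_continuousM;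
    exact: continuous_subspaceW uc.
have coreW : ((amp ^+ 2 * S * J)%:E <= \int[@area R]_(x in W) (v x ^+ 2)%:E)%E.
  rewrite -core; apply: ge0_subset_integral => //.
  - exact: measurableX.
  - by apply/measurable_EFinP/measurable_funX; exact: measurable_funS mv.
  - by move=> x _; rewrite lee_fin sqr_ge0.
have full : (\int[@area R]_(x in rectangle L H) (v x ^+ 2)%:E <=
             (amp ^+ 2 * (J / kp) * (L * H))%:E)%E.
  rewrite EFinM -(area_rectangle hL hH) -integral_cst //.
  apply: ge0_le_integral => //.
  - by move=> x _; rewrite lee_fin sqr_ge0.
  - by apply/measurable_EFinP/measurable_funX.
  move=> [x y] [_ /=]; rewrite in_itv /= => /andP[y0 yH].
  rewrite lee_fin vE /= !exprMn -mulrA; apply: ler_wpM2l; first exact: sqr_ge0.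
  rewrite -[leRHS]mul1r; apply: ler_pM; rewrite ?sqr_ge0 //.
    by rewrite -(cos2Dsin2 (k%:R * pi / L * x)) lerDr sqr_ge0.
  by rewrite ler_pdivlMr // mulrC Jge // !ltW.
apply: L2norm_ratio => //.
- apply: lt_le_trans coreW; rewrite lte_fin mulr_gt0 // mulr_gt0 //.
  exact: lt_le_trans Sge.
- apply: le_trans coreW.
  apply: (@le_trans _ _ ((sg * kp / (L * H))%:E *
                         (amp ^+ 2 * (J / kp) * (L * H))%:E)%E).
    by apply: lee_wpmul2l => //; rewrite lee_fin ltW // divr_gt0 // mulr_gt0.
  rewrite -EFinM lee_fin.
  have -> : sg * kp / (L * H) * (amp ^+ 2 * (J / kp) * (L * H)) =
            amp ^+ 2 * sg * J by field; rewrite !gt_eqF.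
  by rewrite ler_pM2r // ler_pM2l.
- exact: le_lt_trans full (ltry _).
Qed.

Theorem mainTheorem3 (R : realType) (L H : R) (hL : 0 < L) (hH : 0 < H)
    (c : R -> R) (D : set R) (hc : admissible H c D)
    (A : operator) (lambda : nat -> nat -> R) (u : nat -> nat -> R -> R)
    (amp : nat -> nat -> R) (hA : spectral_data A L H c D lambda u amp)
    (eps : R) (heps : 0 < eps)
    (omega1 : set R) (homega1 : open omega1) (homega1_ne : omega1 !=set0)
    (homega1_sub : omega1 `<=` `]0, L[)
    (a b : R) (ha : 0 <= a) (hab : a < b) (hb : b <= H) :
  let omega : set (R * R) := (omega1 `*` `]a, b[) in
  let v k l := eigenfunction L (amp k l) k (u k l) in
  exists C : R,
    0 < C /\
    (forall k l : nat, (1 <= k)%N -> (1 <= l)%N ->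
       lambda k l > (csup H c D + eps) * (k%:R ^+ 2 * pi ^+ 2 / L ^+ 2) ->
       C <= L2norm omega (v k l) / L2norm (rectangle L H) (v k l) <= 1) /\
    (forall t : R * R, translate t omega `<=` rectangle L H ->
       forall k l : nat, (1 <= k)%N -> (1 <= l)%N ->
         lambda k l > (csup H c D + eps) * (k%:R ^+ 2 * pi ^+ 2 / L ^+ 2) ->
         C <= L2norm (translate t omega) (v k l)
                / L2norm (rectangle L H) (v k l) <= 1).
Proof.
move=> omega v.
have [s [ct [m [m0 ctm ctb ctE Ds]]]] := admissible_extension hH hc.
have ct0 x : 0 < ct x by have /andP[h _] := ctb x; exact: lt_le_trans h.
have M0 : 0 < csup H c D by have /andP[_ h] := ctb 0; exact: lt_le_trans h.
have Me0 : 0 < csup H c D + eps by exact: addr_gt0.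
have [a0 [a1 [b0 [b1 [a0_gt0 a1_gt0 b0_gt0 b1_gt0 coef]]]]] :=
  coefficient_bounds A m0 heps ctm ctb.
have [p [q [pq pqO]]] := open_segment homega1 homega1_ne.
have piL : 0 < pi / L :> R by rewrite divr_gt0 ?pi_gt0.
pose lam0 := (csup H c D + eps) * (pi / L) ^+ 2.
have lam0_gt0 : 0 < lam0 by rewrite mulr_gt0 ?exprn_gt0.
pose sg := (q - p) ^+ 5 / 60 /
  (2 * (q - p) ^+ 4 + 2 * (q - p) ^+ 2 / (pi / L) ^+ 2).
pose kp := a0 * b0 / a1 * (b - a) ^+ 5 / 60 /
  (2 * (b - a) ^+ 4 * b1 + 2 * (b - a) ^+ 2 / (a0 * lam0)).
have qp0 : 0 < q - p by rewrite subr_gt0.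
have ba0 : 0 < b - a by rewrite subr_gt0.
have pos d n : 0 < d -> 0 < 2 * d ^+ n :> R.
  by move=> d0; rewrite mulr_gt0 ?exprn_gt0.
have den1 : 0 < 2 * (q - p) ^+ 4 + 2 * (q - p) ^+ 2 / (pi / L) ^+ 2.
  by apply: addr_gt0; rewrite ?divr_gt0 ?pos ?exprn_gt0.
have den2 : 0 < 2 * (b - a) ^+ 4 * b1 + 2 * (b - a) ^+ 2 / (a0 * lam0).
  apply: addr_gt0; first by rewrite mulr_gt0 ?pos.
  by rewrite divr_gt0 ?pos // mulr_gt0.
have sg0 : 0 < sg.
  by apply: divr_gt0 => //; rewrite divr_gt0 ?exprn_gt0.
have kp0 : 0 < kp.
  apply: divr_gt0 => //; rewrite divr_gt0 // mulr_gt0 ?exprn_gt0 //.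
  by rewrite divr_gt0 // mulr_gt0.
(* omega itself is the translate by (0, 0), so one statement covers both. *)
have main (t : R * R) : translate t omega `<=` rectangle L H ->
    forall k l : nat, (1 <= k)%N -> (1 <= l)%N ->
      lambda k l > (csup H c D + eps) * (k%:R ^+ 2 * pi ^+ 2 / L ^+ 2) ->
      Num.sqrt (sg * kp / (L * H)) <= L2norm (translate t omega) (v k l)
             / L2norm (rectangle L H) (v k l) <= 1.
  move=> tO k l k1 l1 hlam.
  have [_ _ /(_ l l1)[sol une] /(_ l l1)[amp0 _]] := hA k k1.
  have [uc _ _ _] := sol.
  have [w osc] := separated_oscillator ct0 ctE Ds sol.
  have kappaE : k%:R ^+ 2 * pi ^+ 2 / L ^+ 2 = (k%:R * pi / L) ^+ 2 :> R.
    by rewrite !exprMn exprVn.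
  have k1R : 1 <= k%:R :> R by rewrite ler1n.
  have mk : pi / L <= k%:R * pi / L :> R by rewrite -mulrA ler_peMl // ltW.
  have lamge : lam0 <= lambda k l.
    apply: le_trans (ltW hlam); rewrite kappaE ler_pM2l // lerXn2r ?nnegrE //.
      exact: ltW.
    exact: le_trans (ltW piL) mk.
  have kappa0 : 0 <= k%:R ^+ 2 * pi ^+ 2 / L ^+ 2 :> R by rewrite kappaE sqr_ge0.
  have [an bn aP bP] := coef _ _ kappa0 hlam.
  have tE := translate_strip omega1 a b t; rewrite -/omega in tE.
  have [at0 btH] : 0 <= a + t.2 /\ b + t.2 <= H.
    apply: sub_itvoo_le; first by rewrite ltrD2r.
    move=> y yab; have : translate t omega (p + t.1, y).
      rewrite tE; split; last by rewrite /= in_itv.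
      by rewrite /= addrK; apply: pqO; rewrite /= in_itv /= lexx ltW.
    by move=> /tO[_]; rewrite /= in_itv.
  apply: (@eigenfunction_ratio _ _ _ hL hH _ (p + t.1) (q + t.1)
            (a + t.2) (b + t.2)) => //.
  - rewrite tE; apply: measurableX => //; apply: open_measurable.
    apply: (@open_comp _ _ (fun x : R => x - t.1)) => // x _.
    by apply: cvgB; [exact: cvg_id|exact: cvg_cst].
  - rewrite tE => -[x y] [/=]; rewrite in_itv /= => xpq yab; split=> //=.
    by apply: pqO; rewrite /= in_itv /= lerBrDr lerBlDr.
  - by rewrite ltrD2r.
  - by rewrite ltrD2r.
  - have := sin_mass piL mk (_ : p + t.1 < q + t.1); rewrite ltrD2r => /(_ pq).
    have -> : q + t.1 - (p + t.1) = q - p by ring.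
    by move=> h; rewrite /sg ler_pdivrMr // [leRHS]mulrC.
  - move=> x xH.
    have := @oscillator_observable _ _ (a + t.2) (b + t.2) _ _ _ _ _ _ _ _ _ _ _
      at0 _ btH osc a0_gt0 b0_gt0 lam0_gt0 lamge an bn aP bP x xH.
    rewrite ltrD2r => /(_ hab).
    have -> : b + t.2 - (a + t.2) = b - a by ring.
    by move=> h; rewrite /kp mulrAC ler_pdivrMr // [leRHS]mulrC.
exists (Num.sqrt (sg * kp / (L * H))); split.
  by rewrite sqrtr_gt0 !(divr_gt0, mulr_gt0).
split=> //.
have t0 : translate (0, 0) omega = omega.
  rewrite translate_strip /omega /= !addr0; congr (_ `*` _).
  by apply/seteqP; split=> x /=; rewrite subr0.
move=> k l k1 l1 hlam; rewrite -[omega]t0; apply: main => //.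
rewrite t0 => -[x y] [/homega1_sub xL]; rewrite /= in_itv /= => /andP[ay yb].
split=> //=; rewrite in_itv /= (le_lt_trans ha ay).
exact: lt_le_trans hb.
Qed.
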